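(* Assume the homogeneous-expert regime ($h_0=h$) and that the expert function $h$ is strongly identifiable, and let $(l_n)_{n\ge1}$ be a sequence with $l_n/\log n\to\infty$ as $n\to\infty$. Then the minimax lower bounds $$\inf_{\overline G_n}\ \sup_{G\in\Xi(l_n)}\mathbb{E}_{p_{G,n}}\Big[\sum_{i=1}^{K-1}\|\Delta\eta_i\|^4\times|\exp(\overline\tau_n)-\exp(\tau)|^2\Big]\ \gtrsim\ n^{-1/r},$$ $$\inf_{\overline G_n}\ \sup_{G\in\Xi(l_n)}\mathbb{E}_{p_{G,n}}\Big[\exp^2(\tau)\sum_{i=1}^{K-1}\|\Delta\eta_i\|^2\big(\|\overline\beta_n-\beta\|^2+\|\overline\eta_{n,i}-\eta_i\|^2\big)\Big]\ \gtrsim\ n^{-1/r}$$ hold for any $0<r<1$. Here the infimum is over all estimators $\overline G_n=(\overline\beta_n,\overline\tau_n,\overline\eta_n)$ taking values in $\Xi$, and the expectation is with respect to the joint distribution $p_{G,n}$ of the $n$ i.i.d. observations generated under $G=(\beta,\tau,\eta)\in\Xi(l_n)$.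
   Context: Model. Let $d,q,K\in\mathbb{N}$, $[K]=\{1,\dots,K\}$, and let $\mathcal{X}\subset\mathbb{R}^d$ be bounded. $X$ is a random covariate in $\mathcal{X}$ and $Y\in[K]$ is a discrete response. The pretrained parameter $\eta_0=(\eta_{01},\dots,\eta_{0K})\in\mathbb{R}^{q\times K}$, $\eta_{0i}\in\mathbb{R}^q$, is fixed and known. The expert functions are $h_0,h:\mathcal{X}\times\mathbb{R}^q\to\mathbb{R}$; $h_0$ is known. The unknown parameter is $G=(\beta,\tau,\eta)$ with $\beta\in\mathbb{R}^d$, $\tau\in\mathbb{R}$, $\eta=(\eta_1,\dots,\eta_K)\in\mathbb{R}^{q\times K}$, $\eta_i\in\mathbb{R}^q$, lying in a compact set $\Xi\subseteq\mathbb{R}^d\times\mathbb{R}\times\mathbb{R}^{q\times K}$. For $s\in[K]$, $$p_G(y=s|x)=\frac{1}{1+\exp(\beta^\top x+\tau)}\cdot\frac{\exp(h_0(x,\eta_{0s}))}{\sum_{i=1}^K\exp(h_0(x,\eta_{0i}))}+\frac{\exp(\beta^\top x+\tau)}{1+\exp(\beta^\top x+\tau)}\cdot\frac{\exp(h(x,\eta_s))}{\sum_{j=1}^K\exp(h(x,\eta_j))}.$$ The data $(X_1,Y_1),\dots,(X_n,Y_n)$ are i.i.d. with $Y_i\mid X_i\sim p_G(\cdot|X_i)$, with joint law $p_{G,n}$; the true parameter may depend on $n$. Homogeneous-expert regime: the pretrained and adapter experts share the same functional form, $h_0=h$, and differ only in parameter values. Notation. $\|\cdot\|$ is the Euclidean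 norm. $a_n\gtrsim b_n$ means $a_n\ge C b_n$ for all $n$ with a constant $C>0$ independent of $n$. $\Delta\eta_i=\eta_i-\eta_{0i}$. $\eta_{i,u}$ and $\beta_v$ denote coordinates of $\eta_i$ and $\beta$. $\exp^2(\tau)=(\exp(\tau))^2$. Restricted parameter space: $$\Xi(l_n)=\Big\{G=(\beta,\tau,\eta)\in\Xi:\ \frac{l_n}{\min_{1\le u\le q,\,1\le v\le d}\{|\eta_{i,u}|^2,|\beta_v|^2\}\sqrt n}\le\exp(\tau)\ \text{ for all } i\in[K]\Big\}.$$ Strong identifiability. The expert function $h$ is strongly identifiable if it is twice differentiable in its parameter for almost every $x\in\mathcal{X}$ and if, for any fixed $\beta\in\mathbb{R}^d$ and any parameters $\eta_1,\dots,\eta_K\in\mathbb{R}^q$, each of the following two sets of real-valued functions of $x$ is linearly independent over $\mathbb{R}$, where $\frac{\partial h}{\partial\eta_i^{(u)}}$ and $\frac{\partial^2h}{\partial\eta_i^{(u)}\partial\eta_i^{(v)}}$ denote the partial derivatives of $h(x,\eta_i)$ with respect to coordinates of $\eta_i$, and $x^{(w)}$ is the $w$-th coordinate of $x$: (1) $\Big\{\frac{\partial h}{\partial\eta_i^{(u)}}\frac{\partial h}{\partial\eta_j^{(v)}},\ \exp(\beta^\top x)\frac{\partial h}{\partial\eta_i^{(u)}}\frac{\partial h}{\partial\eta_j^{(v)}}:\ u,v\in[q],\ i,j\in[K]\Big\}$; (2) $\Big\{\frac{\partial h}{\partial\eta_i^{(u)}},\ x^{(w)}\frac{\partial h}{\partial\eta_i^{(u)}},\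 \exp(\beta^\top x)\frac{\partial h}{\partial\eta_i^{(u)}},\ \frac{\partial^2h}{\partial\eta_i^{(u)}\partial\eta_i^{(v)}},\ \exp(\beta^\top x)\frac{\partial^2h}{\partial\eta_i^{(u)}\partial\eta_i^{(v)}}:\ u,v\in[q],\ w\in[d],\ i\in[K]\Big\}$.
   Formalization: The formal statement adds that K is at least 2 and that the intersection of the sets Ξ(l_n) over all n ≥ 1 has nonempty interior; without these the claim fails (for K = 1, or for Ξ a single point, the risks are zero). *)

(* Defs.v *)
From HB Require Import structures.
From mathcomp Require Import all_boot all_order all_algebra.
From mathcomp Require Import all_classical all_reals all_analysis.

Set Implicit Arguments.
Unset Strict Implicit.
Unset Printing Implicit Defensive.

Import Order.TTheory GRing.Theory Num.Theory.
Import numFieldNormedType.Exports.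

Local Open Scope classical_set_scope.
Local Open Scope ring_scope.

(* The Borel sigma-algebra of a topological space (the carrier is unchanged). *)
Notation borel T := (g_sigma_algebraType (@open T)).

Section Euclidean.
Context {R : realType}.

Definition dot m (u v : 'cV[R]_m) : R := \sum_(k < m) u k 0 * v k 0.

(* The library norm on matrices is the sup norm, hence this definition. *)
Definition l2norm m (v : 'cV[R]_m) : R := Num.sqrt (\sum_(k < m) v k 0 ^+ 2).

End Euclidean.

Section Iid.
Context d (T : measurableType d) {R : realType}.

Definition tcons n (z : T * n.-tuple T) : n.+1.-tuple T :=
  [the n.+1.-tuple T of z.1 :: z.2].

Lemma measurable_tcons n : measurable_fun [set: T * n.-tuple T] (@tcons n).
Proof. exact: measurable_cons. Qed.

HB.instance Definition _ n :=
  isMeasurableFun.Build _ _ _ _ (@tcons n) (@measurable_tcons n).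

(* The n-fold product of mu, a probability on n-tuples: the law of n
   independent draws from mu. *)
Fixpoint iid (mu : probability T R) n : probability (n.-tuple T) R :=
  match n with
  | 0 => @dirac _ _ ([tuple] : 0.-tuple T) R
  | m.+1 => distribution (mu \x iid mu m)%E (@tcons m)
  end.

End Iid.

Arguments iid {d T R} mu n.

(* Parameters (beta, tau, eta) in R^d x R x R^(q x K); eta_i is column i of eta. *)
Notation param R d q K := ('cV[R]_d * R * 'M[R]_(q, K))%type.

Section Model.
Context {R : realType} {d q K : nat}.

Local Notation covariate := (borel 'cV[R]_d).

Local Notation param := (param R d q K).

Definition par_beta (G : param) : 'cV[R]_d := G.1.1.
Definition par_tau (G : param) : R := G.1.2.
Definition par_eta (G : param) : 'M[R]_(q, K) := G.2.

(* Experts are total on R^d; only their values on the covariate domain matter. *)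
Definition expert : Type := 'cV[R]_d -> 'cV[R]_q -> R.

Definition softmax (h : expert) (eta : 'M[R]_(q, K)) (x : 'cV[R]_d)
    (s : 'I_K) : R :=
  expR (h x (col s eta)) / \sum_(i < K) expR (h x (col i eta)).

Definition cond_density (h0 h : expert) (eta0 : 'M[R]_(q, K)) (G : param)
    (x : 'cV[R]_d) (s : 'I_K) : R :=
  let w := expR (dot (par_beta G) x + par_tau G) in
  1 / (1 + w) * softmax h0 eta0 x s + w / (1 + w) * softmax h (par_eta G) x s.

Definition sample_domain (X : set covariate) n : set (n.-tuple covariate) :=
  [set x | forall k, X (tnth x k)].
Arguments sample_domain : clear implicits.

(* Expectation of f under p_{G,n}, the law on (X x [K])^n whose density with
   respect to mu^n times the counting measure is the product of the conditional
   densities, mu being the law of the covariate. *)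
Definition expectation_iid (h0 h : expert) (eta0 : 'M[R]_(q, K))
    (X : set covariate) (mu : probability covariate R) (G : param) n
    (f : n.-tuple covariate -> n.-tuple 'I_K -> R) : \bar R :=
  (\sum_(y : n.-tuple 'I_K)
    \int[iid mu n]_(x in sample_domain X n)
      ((\prod_(k < n) cond_density h0 h eta0 G (tnth x k) (tnth y k))
        * f x y)%:E)%E.

(* Estimators based on n observations with values in Xi; as labels are
   discrete, measurability is required in the covariates for fixed labels. *)
Definition estimator (X : set covariate) (Xi : set param) n
    (est : n.-tuple covariate -> n.-tuple 'I_K -> param) : Prop :=
  (forall y, measurable_fun (sample_domain X n) (est^~ y : _ -> borel param))
  /\ (forall x y, sample_domain X n x -> Xi (est x y)).

Definition minimax_risk (h0 h : expert) (eta0 : 'M[R]_(q, K))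
    (X : set covariate) (mu : probability covariate R)
    (Xi Theta : set param) (loss : param -> param -> R) n : \bar R :=
  ereal_inf [set ereal_sup
      [set expectation_iid h0 h eta0 X mu G (fun x y => loss (est x y) G)
        | G in Theta]
    | est in @estimator X Xi n].

(* The minimum of the |eta_(i,u)|^2 and |beta_v|^2 (a finite nonempty set when
   d and q are positive). *)
Definition min_sq (G : param) (i : 'I_K) : R :=
  inf ([set `|par_eta G u i| ^+ 2 | u in [set: 'I_q]] `|`
       [set `|par_beta G v 0| ^+ 2 | v in [set: 'I_d]]).

(* Positivity of the minimum is explicit because l / 0 = 0 in MathComp, while
   a vanishing coordinate is excluded from the restricted space. *)
Definition restricted (Xi : set param) (l : R) n : set param :=
  [set G | Xi G /\ forall i : 'I_K,
    0 < min_sq G i /\ l / (min_sq G i * Num.sqrt n%:R) <= expR (par_tau G)].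

Definition delta_eta (eta0 : 'M[R]_(q, K)) (G : param) (i : 'I_K) : 'cV[R]_q :=
  col i (par_eta G) - col i eta0.

(* Sums over i = 1, ..., K-1; the indices of 'I_K are shifted by one. *)
Definition loss_tau (eta0 : 'M[R]_(q, K)) (Gbar G : param) : R :=
  \sum_(i < K | (i.+1 < K)%N) l2norm (delta_eta eta0 G i) ^+ 4
    * `|expR (par_tau Gbar) - expR (par_tau G)| ^+ 2.

Definition loss_beta_eta (eta0 : 'M[R]_(q, K)) (Gbar G : param) : R :=
  expR (par_tau G) ^+ 2 *
  \sum_(i < K | (i.+1 < K)%N) l2norm (delta_eta eta0 G i) ^+ 2
    * (l2norm (par_beta Gbar - par_beta G) ^+ 2
       + l2norm (col i (par_eta Gbar) - col i (par_eta G)) ^+ 2).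

Definition partial (h : expert) (u : 'I_q) (eta : 'cV[R]_q) (x : 'cV[R]_d) : R :=
  'D_(delta_mx u 0) (h x) eta.

Definition partial2 (h : expert) (u v : 'I_q) (eta : 'cV[R]_q)
    (x : 'cV[R]_d) : R :=
  'D_(delta_mx v 0) (fun e => partial h u e x) eta.

Definition twice_differentiable (h : expert) (x : 'cV[R]_d) : Prop :=
  forall eta : 'cV[R]_q, differentiable (h x) eta
    /\ forall u, differentiable (fun e : 'cV[R]_q => partial h u e x) eta.

(* Linear independence of a set of functions identified mu-almost everywhere:
   every finite family of pairwise non-equivalent members is independent.
   Working with sets rather than indexed families matters: the families below
   have repeated entries (exchange (i, u) and (j, v), equal eta_i, beta = 0). *)
Definition ae_lin_independent (mu : probability covariate R)
    (S : set ('cV[R]_d -> R)) : Prop :=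
  forall (m : nat) (f : 'I_m -> 'cV[R]_d -> R) (c : 'I_m -> R),
    (forall k, S (f k)) ->
    (forall j k, j != k -> ~ {ae mu, forall x : covariate, f j x = f k x}) ->
    {ae mu, forall x : covariate, \sum_(k < m) c k * f k x = 0} ->
    forall k, c k = 0.

Definition first_order_products (h : expert) (beta : 'cV[R]_d)
    (eta : 'M[R]_(q, K)) : set ('cV[R]_d -> R) :=
  [set f | exists (u v : 'I_q) (i j : 'I_K),
    let g x := partial h u (col i eta) x * partial h v (col j eta) x in
    f = g \/ f = (fun x => expR (dot beta x) * g x)].

Definition derivatives_upto2 (h : expert) (beta : 'cV[R]_d)
    (eta : 'M[R]_(q, K)) : set ('cV[R]_d -> R) :=
  [set f | exists (u v : 'I_q) (w : 'I_d) (i : 'I_K),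
    let g x := partial h u (col i eta) x in
    let g2 x := partial2 h u v (col i eta) x in
    [\/ f = g, f = (fun x => x w 0 * g x),
        f = (fun x => expR (dot beta x) * g x) |
        f = g2 \/ f = (fun x => expR (dot beta x) * g2 x)]].

(* "Almost every x" refers to the law mu of the covariate. *)
Definition strongly_identifiable (mu : probability covariate R)
    (h : expert) : Prop :=
  {ae mu, forall x : covariate, twice_differentiable h x} /\
  forall (beta : 'cV[R]_d) (eta : 'M[R]_(q, K)),
    ae_lin_independent mu (first_order_products h beta eta) /\
    ae_lin_independent mu (derivatives_upto2 h beta eta).

End Model.

Arguments strongly_identifiable {R d q} K mu h.

(* Main.v *)
(* Le Cam's two-point method at distance t = c / sqrt n. A point G of the interior
   with eta_1 <> eta_01 is perturbed in tau (first loss) or in one coordinate of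
   beta (second loss). On the bounded set X the logit beta^T x + tau moves by at
   most b t, so, whatever the experts are, the conditional densities satisfy
   |p1 - p0| <= eps p0 with eps = expR (b t) - 1. For every fixed x this gives
   sum_y p1^2 / p0 <= (1 + eps^2)^n <= 2 for the products of the densities, and
   min p0 p1 >= p1 - p1^2 / (4 p0) then bounds the overlap from below by 1 / 2.
   The resulting lower bound is of order 1 / n >= n^(-1/r). *)

Require Import Defs.
From HB Require Import structures.
From mathcomp Require Import all_boot all_order all_algebra.
From mathcomp Require Import all_classical all_reals all_analysis.
From mathcomp Require Import measurable_realfun ring lra.

Set Implicit Arguments.
Unset Strict Implicit.
Unset Printing Implicit Defensive.

Import Order.TTheory GRing.Theory Num.Theory.
Import numFieldNormedType.Exports.

Local Open Scope classical_set_scope.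
Local Open Scope ring_scope.

(** * Overlap and chi-square bounds for laws on a finite set *)

Section Overlap.
Context {R : realFieldType}.

(** Multiplied by [p0], the gap between [p0] and the left side is the perfect square
    [(p0 - p1 / 2) ^+ 2]. This turns a second-moment bound on the likelihood ratio into a bound on
    the overlap. *)
Lemma min_ge_sub_sqr (p0 p1 : R) : 0 < p0 -> 0 <= p1 ->
  p1 - p1 ^+ 2 / p0 / 4 <= Num.min p0 p1.
Proof.
move=> p0_gt0 p1_ge0; rewrite le_min; apply/andP; split; last first.
  by rewrite gerBl !mulr_ge0 ?invr_ge0 ?exprn_ge0 ?(ltW p0_gt0).
rewrite -(ler_pM2r p0_gt0) -subr_ge0.
have -> : p0 * p0 - (p1 - p1 ^+ 2 / p0 / 4) * p0 = (p0 - p1 / 2) ^+ 2.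
  by field; rewrite gt_eqF.
exact: sqr_ge0.
Qed.

(** Le Cam's argument on a finite space: since [f0] and [f1] cannot both be small at [y], each [y]
    contributes at least [s] times the smaller weight. The weights need not be normalized here. *)
Lemma two_weight_sum_ge (Y : finType) (p0 p1 f0 f1 : Y -> R) (s : R) :
  (forall y, 0 < p0 y) -> (forall y, 0 <= p1 y) ->
  (forall y, 0 <= f0 y) -> (forall y, 0 <= f1 y) ->
  0 <= s -> (forall y, s <= f0 y + f1 y) ->
  s * (\sum_y p1 y - (\sum_y p1 y ^+ 2 / p0 y) / 4)
    <= \sum_y (p0 y * f0 y + p1 y * f1 y).
Proof.
move=> p0_gt0 p1_ge0 f0_ge0 f1_ge0 s_ge0 sep.
rewrite mulr_suml -sumrB mulr_sumr; apply: ler_sum => y _.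
have min_ge0 : 0 <= Num.min (p0 y) (p1 y) by rewrite le_min ltW /=.
have := min_ge_sub_sqr (p0_gt0 y) (p1_ge0 y).
move=> /(ler_wpM2l s_ge0)/le_trans; apply.
apply: (@le_trans _ _ ((f0 y + f1 y) * Num.min (p0 y) (p1 y))).
  exact: ler_wpM2r.
rewrite mulrDl lerD // mulrC ler_wpM2r // ge_min lexx ?orbT //.
Qed.

(** Expanding the square around [p0] gives [p1 ^+ 2 / p0 = 2 * p1 - p0 + (p1 - p0) ^+ 2 / p0]; the
    linear part sums to 1 and the remainder is at most [e ^+ 2 * p0]. *)
Lemma sum_sqr_div_le (Y : finType) (p0 p1 : Y -> R) (e : R) :
  (forall y, 0 < p0 y) -> \sum_y p0 y = 1 -> \sum_y p1 y = 1 ->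
  (forall y, `|p1 y - p0 y| <= e * p0 y) ->
  \sum_y p1 y ^+ 2 / p0 y <= 1 + e ^+ 2.
Proof.
move=> p0_gt0 p0_sum1 p1_sum1 near_p.
have -> : 1 + e ^+ 2 = \sum_y (2 * p1 y - p0 y + e ^+ 2 * p0 y).
  by rewrite big_split sumrB -!mulr_sumr p0_sum1 p1_sum1 /=; ring.
apply: ler_sum => y _; rewrite ler_pdivrMr // -subr_ge0.
have -> : (2 * p1 y - p0 y + e ^+ 2 * p0 y) * p0 y - p1 y ^+ 2 =
    (e * p0 y) ^+ 2 - `|p1 y - p0 y| ^+ 2 by rewrite real_normK ?num_real//; ring.
by rewrite subr_ge0 ler_sqr ?nnegrE ?(le_trans _ (near_p y)).
Qed.

(** Independence in algebraic form: it gives product weights total mass one and makes the chi-square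
    sum tensorize. *)
Lemma sum_prod_tuple (T : finType) n (f : 'I_n -> T -> R) :
  \sum_(y : n.-tuple T) \prod_k f k (tnth y k) = \prod_k \sum_s f k s.
Proof.
rewrite bigA_distr_bigA (reindex (fun g : {ffun 'I_n -> T} => [tuple g i | i < n])).
  by apply: eq_bigr => g _; apply: eq_bigr => k _; rewrite tnth_mktuple.
exists (fun y : n.-tuple T => [ffun i => tnth y i]) => [g _|y _].
  by apply/ffunP => i; rewrite ffunE tnth_mktuple.
by apply: eq_from_tnth => i; rewrite tnth_mktuple ffunE.
Qed.

End Overlap.

(** * Sensitivity of a logistic mixture to its logit *)

Section Exponential.
Context {R : realType}.

(** From [1 - t <= expR (- t)] one gets [expR t - 1 <= t * expR t], and also [expR t <= 2] because
    [t] is at most one half. *)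
Lemma expR_sub1_le (t : R) : 0 <= t <= 2^-1 -> expR t - 1 <= 2 * t.
Proof.
move=> /andP[t_ge0 t_le]; have := expR_ge1Dx (- t); rewrite expRN => le_inv.
have E0 := expR_gt0 t.
have : (1 - t) * expR t <= 1 by rewrite -ler_pdivlMr // mul1r.
nra.
Qed.

Definition logistic_mix (a b z : R) : R :=
  1 / (1 + expR z) * a + expR z / (1 + expR z) * b.

(** The bound is relative and uniform in [a] and [b], hence independent of the experts. The
    difference is proportional to [(b - a) * (expR v - expR u)], with [b - a] at most [a + b] in
    absolute value. *)
Lemma logistic_mix_perturb (u v a b t : R) : 0 < a -> 0 < b -> `|v - u| <= t ->
  `|logistic_mix a b v - logistic_mix a b u| <=
    (expR t - 1) * logistic_mix a b u.
Proof.
move=> a_gt0 b_gt0 uv_le; set p := logistic_mix a b.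
have u_gt0 := expR_gt0 u; have v_gt0 := expR_gt0 v; have t_gt0 := expR_gt0 t.
have uDn0 : 1 + expR u != 0 by rewrite gt_eqF // addr_gt0.
have vDn0 : 1 + expR v != 0 by rewrite gt_eqF // addr_gt0.
have [t1 t2] : - t <= v - u /\ v - u <= t.
  by move: uv_le; rewrite ler_norml => /andP.
have vu : expR v <= expR u * expR t by rewrite -expRD ler_expR; lra.
have uv : expR u <= expR v * expR t by rewrite -expRD ler_expR; lra.
have t_ge1 : 1 <= expR t by rewrite -(@expR0 R) ler_expR (le_trans _ uv_le).
rewrite [p v - p u](_ : _ =
    (b - a) * (expR v - expR u) / ((1 + expR v) * (1 + expR u))); last first.
  by rewrite /p /logistic_mix; field; rewrite uDn0 vDn0.
rewrite [p u](_ : _ =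
    (a + expR u * b) * (1 + expR v) / ((1 + expR v) * (1 + expR u))); last first.
  by rewrite /p /logistic_mix; field; rewrite uDn0 vDn0.
have d_gt0 : 0 < (1 + expR v) * (1 + expR u) by rewrite mulr_gt0 ?addr_gt0.
rewrite normrM [X in _ * X]gtr0_norm ?invr_gt0 // mulrA ler_pM2r ?invr_gt0 //.
rewrite normrM.
(* The first bound is paired with [a] and the second with [b]; these match the terms [a * expR v]
   and [expR u * b] in the expansion of [(a + expR u * b) * (1 + expR v)]. *)
have [vd ud] : `|expR v - expR u| <= (expR t - 1) * expR v /\
    `|expR v - expR u| <= (expR t - 1) * expR u.
  by split; rewrite ler_norml; have [?|?] := leP (expR u) (expR v); nra.
have ba : `|b - a| <= a + b by rewrite ler_norml; lra.
have n0 := normr_ge0 (expR v - expR u).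
apply: (le_trans (ler_wpM2r n0 ba)).
have := ler_wpM2l (ltW a_gt0) vd; have := ler_wpM2l (ltW b_gt0) ud.
have e0 : 0 <= expR t - 1 by rewrite subr_ge0.
have := mulr_ge0 e0 (ltW a_gt0).
have := mulr_ge0 e0 (ltW (mulr_gt0 (mulr_gt0 u_gt0 v_gt0) b_gt0)).
lra.
Qed.

End Exponential.

(** * Measurability tools *)

(* The pointed and the topological structure are separate because a product of
   topological spaces has no canonical pointed topological structure. *)
Lemma measurable_fun_g_sigma_algebra {R : realType} (T : pointedType)
    (opens : set (set T)) (f : T -> R) :
  (forall a, opens (f @^-1` `]a, +oo[)) ->
  measurable_fun [set: g_sigma_algebraType opens] f.
Proof.
move=> open_f; apply: (measurability _ (RGenOInfty.measurableE R)).
move=> /= _ [_ [a ->] <-]; rewrite setTI.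
exact: sub_sigma_algebra.
Qed.

Lemma open_preimage_ray {R : realType} (T : topologicalType) (f : T -> R) a :
  continuous f -> open (f @^-1` `]a, +oo[).
Proof. by move=> /continuousP cf; exact/cf/interval_open. Qed.

Lemma measurable_fun_invr d (T : measurableType d) {R : realType} (D : set T)
    (f : T -> R) : (forall x, 0 < f x) ->
  measurable_fun D f -> measurable_fun D (fun x => (f x)^-1).
Proof.
move=> f_gt0 mf.
apply: (eq_measurable_fun (fun x => f x `^ (-1))) => [x _|].
  by rewrite powR_inv1 // ltW.
exact: (measurableT_comp (measurable_powR (-1))).
Qed.

Lemma measurable_sum_cond d (T : measurableType d) {R : realType} (D : set T)
    (I : Type) (r : seq I) (P : pred I) (f : I -> T -> R) :
  (forall i, measurable_fun D (f i)) ->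
  measurable_fun D (fun x => \sum_(i <- r | P i) f i x).
Proof.
by move=> mf; under eq_fun do rewrite -big_filter; exact: measurable_sum.
Qed.

(** * The set of samples with all covariates in [X] *)

Section SampleDomain.
Context {R : realType} {d : nat}.
Local Notation covariate := (borel 'cV[R]_d).
Variables (X : set covariate) (mX : measurable X).

Lemma measurable_sample_domain n : measurable (@sample_domain R d X n).
Proof.
rewrite (_ : @sample_domain R d X n =
    \bigcap_(k in [set: 'I_n]) ((fun x => tnth x k) @^-1` X)); last first.
  by apply/seteqP; split => [x Xx k _|x Xx k]; [exact: Xx|exact: Xx].
apply: (@fin_bigcap_measurable _ _ 'I_n setT (fun k =>
  (fun x : n.-tuple covariate => tnth x k) @^-1` X)) => // k _.
by rewrite -[Y in measurable Y]setTI; exact: measurable_tnth.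
Qed.

(** By induction along [tcons], which pulls the domain back to a rectangle. It makes the integral of
    a constant over the domain equal to that constant. *)
Lemma iid_sample_domain (mu : probability covariate R) n :
  mu X = 1%E -> iid mu n (@sample_domain R d X n) = 1%E.
Proof.
move=> muX; elim: n => [|n IHn].
  by rewrite /= diracE mem_set // => -[].
rewrite /= /distribution /pushforward /=.
rewrite (_ : _ @^-1` _ = X `*` @sample_domain R d X n); last first.
  apply/seteqP; split => [[x xs] Xx|[x xs] /= [Xx Xxs] k].
    split => /= [|k]; first by have := Xx ord0; rewrite tnth0.
    by have := Xx (lift ord0 k); rewrite tnthS.
  have [->|[j ->]] : k = ord0 \/ exists j, k = lift ord0 j.
    by case: (unliftP ord0 k) => [j ->|->]; [right; exists j|left].
  - by rewrite tnth0.
  - by rewrite tnthS.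
rewrite product_measure1E //; last exact: measurable_sample_domain.
by rewrite -[RHS]mule1; congr (_ * _)%E.
Qed.

End SampleDomain.

Lemma measurable_dot {R : realType} m (b : 'cV[R]_m) :
  measurable_fun [set: borel 'cV[R]_m] (dot b : borel 'cV[R]_m -> R).
Proof.
apply: measurable_sum => k; apply: measurable_funM => //.
apply: measurable_fun_g_sigma_algebra => a; apply: open_preimage_ray.
exact: coord_continuous.
Qed.

(** * Positivity, normalization, perturbation and measurability of the conditional density *)

Section ConditionalDensity.
Context {R : realType} {d q K : nat}.
Local Notation covariate := (borel 'cV[R]_d).
Local Notation param := (param R d q K).
Variables (h0 h : 'cV[R]_d -> 'cV[R]_q -> R) (eta0 : 'M[R]_(q, K)).

Lemma sum_expR_gt0 (g : 'I_K -> R) (s : 'I_K) : 0 < \sum_i expR (g i).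
Proof.
rewrite (bigD1 s) //=; apply: ltr_pwDl; first exact: expR_gt0.
by apply: sumr_ge0 => i _; exact: expR_ge0.
Qed.

Lemma softmax_gt0 (g : @expert R d q) (eta : 'M[R]_(q, K)) x s : 0 < softmax g eta x s.
Proof. by apply: divr_gt0; [exact: expR_gt0|exact: (sum_expR_gt0 _ s)]. Qed.

Lemma sum_softmax (g : @expert R d q) (eta : 'M[R]_(q, K)) x :
  (0 < K)%N -> \sum_s softmax g eta x s = 1.
Proof.
move=> K_gt0; rewrite -mulr_suml divff // gt_eqF //.
exact: (sum_expR_gt0 _ (Ordinal K_gt0)).
Qed.

Lemma cond_densityE (G : param) x s : cond_density h0 h eta0 G x s =
  logistic_mix (softmax h0 eta0 x s) (softmax h (par_eta G) x s)
    (dot (par_beta G) x + par_tau G).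
Proof. by []. Qed.

Lemma cond_density_gt0 (G : param) x s : 0 < cond_density h0 h eta0 G x s.
Proof.
have w_gt0 := expR_gt0 (dot (par_beta G) x + par_tau G).
have a_gt0 := softmax_gt0 h0 eta0 x s; have b_gt0 := softmax_gt0 h (par_eta G) x s.
by rewrite addr_gt0 // mulr_gt0 // divr_gt0 // addr_gt0.
Qed.

Lemma sum_cond_density (G : param) x :
  (0 < K)%N -> \sum_s cond_density h0 h eta0 G x s = 1.
Proof.
move=> K_gt0; have w_gt0 := expR_gt0 (dot (par_beta G) x + par_tau G).
rewrite big_split /= -!mulr_sumr !sum_softmax // !mulr1 -mulrDl divff // gt_eqF ?addr_gt0.
Qed.

(** With [eta] held fixed, both softmax factors are shared and only the logit moves. *)
Lemma cond_density_perturb (G0 G1 : param) x s t : par_eta G1 = par_eta G0 ->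
  `|(dot (par_beta G1) x + par_tau G1) - (dot (par_beta G0) x + par_tau G0)| <= t ->
  `|cond_density h0 h eta0 G1 x s - cond_density h0 h eta0 G0 x s| <=
    (expR t - 1) * cond_density h0 h eta0 G0 x s.
Proof.
move=> eqeta le_t; rewrite !cond_densityE eqeta.
by apply: logistic_mix_perturb; rewrite ?softmax_gt0.
Qed.

Variables (X : set covariate) (mX : measurable X).
Hypothesis homogeneous : forall x eta, X x -> h0 x eta = h x eta.
Hypothesis h_meas : forall eta : 'cV[R]_q,
  measurable_fun X (h^~ eta : covariate -> R).

Lemma measurable_softmax (eta : 'M[R]_(q, K)) s :
  measurable_fun X (fun x : covariate => softmax h eta x s).
Proof.
apply: measurable_funM; first exact: measurableT_comp.
apply: measurable_fun_invr => [x|]; first exact: (sum_expR_gt0 _ s).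
by apply: measurable_sum => i; exact: measurableT_comp.
Qed.

Lemma measurable_cond_density (G : param) s :
  measurable_fun X (fun x : covariate => cond_density h0 h eta0 G x s).
Proof.
(* Measurability is assumed for [h], so on [X] homogeneity replaces [h0] by [h]. *)
apply: (eq_measurable_fun (fun x : covariate =>
    (logistic_mix (softmax h eta0 x s) (softmax h (par_eta G) x s)
      (dot (par_beta G) x + par_tau G)))) => [x /set_mem Xx|].
  rewrite cond_densityE /softmax homogeneous //; congr (logistic_mix (_ / _) _ _).
  by apply: eq_bigr => i _; rewrite homogeneous.
have mw : measurable_fun X (fun x : covariate => expR (dot (par_beta G) x + par_tau G)).
  apply: measurableT_comp => //; apply: measurable_funD => //.
  by apply/measurable_funTS; exact: measurable_dot.
have mV : measurable_fun X
    (fun x : covariate => (1 + expR (dot (par_beta G) x + par_tau G))^-1).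
  apply: measurable_fun_invr => [x|]; first by rewrite addr_gt0 ?expR_gt0.
  exact: measurable_funD.
have m1 : measurable_fun X (fun x : covariate =>
    1 / (1 + expR (dot (par_beta G) x + par_tau G))) by exact: measurable_funM.
have m2 : measurable_fun X (fun x : covariate =>
    expR (dot (par_beta G) x + par_tau G) /
      (1 + expR (dot (par_beta G) x + par_tau G))) by exact: measurable_funM.
exact: (measurable_funD (measurable_funM m1 (measurable_softmax eta0 s))
  (measurable_funM m2 (measurable_softmax (par_eta G) s))).
Qed.

End ConditionalDensity.

(** * Le Cam's two-point bound for the minimax risk *)

Section TwoPoint.
Context {R : realType} {d q K : nat}.
Local Notation covariate := (borel 'cV[R]_d).
Local Notation param := (param R d q K).
Variables (h0 h : 'cV[R]_d -> 'cV[R]_q -> R) (eta0 : 'M[R]_(q, K)).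
Variables (X : set covariate) (mX : measurable X).
Variables (mu : probability covariate R) (mu_X : mu X = 1%E).
Hypothesis homogeneous : forall x eta, X x -> h0 x eta = h x eta.
Hypothesis h_meas : forall eta : 'cV[R]_q,
  measurable_fun X (h^~ eta : covariate -> R).
Hypothesis K_gt0 : (0 < K)%N.

Local Notation density := (cond_density h0 h eta0).
Local Notation domain n := (@sample_domain R d X n).

Lemma measurable_prod_density (G : param) n (y : n.-tuple 'I_K) :
  measurable_fun (domain n) (fun x : n.-tuple covariate =>
    \prod_(k < n) density G (tnth x k) (tnth y k)).
Proof.
apply: measurable_prod => k _.
apply: (measurable_comp (F := X) (f := fun x : covariate => density G x (tnth y k))
  (g := fun x : n.-tuple covariate => tnth x k)) => //.
- by move=> _ [x Xx <-]; exact: Xx.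
- exact: measurable_cond_density.
- by apply: measurable_funTS; exact: measurable_tnth.
Qed.

Section Expectation.
Variables (G : param) (n : nat) (f : n.-tuple covariate -> n.-tuple 'I_K -> R).
Hypothesis mf : forall y, measurable_fun (domain n) (f^~ y).

Let measurable_prod_densityM (y : n.-tuple 'I_K) :
  measurable_fun (domain n) (fun x : n.-tuple covariate =>
    (\prod_(k < n) density G (tnth x k) (tnth y k)) * f x y).
Proof. by apply: measurable_funM => //; exact: measurable_prod_density. Qed.

Lemma measurable_sum_density :
  measurable_fun (domain n) (fun x : n.-tuple covariate => \sum_(y : n.-tuple 'I_K)
    (\prod_(k < n) density G (tnth x k) (tnth y k)) * f x y).
Proof. by apply: measurable_sum => y; exact: measurable_prod_densityM. Qed.

(** Moving the sum over labels inside the integral reduces the comparison of two risks to finite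
    label laws at a fixed covariate sample. *)
Lemma expectation_iidE : (forall x y, 0 <= f x y) ->
  expectation_iid h0 h eta0 X mu G f =
  (\int[iid mu n]_(x in domain n) (\sum_(y : n.-tuple 'I_K)
     (\prod_(k < n) density G (tnth x k) (tnth y k)) * f x y)%:E)%E.
Proof.
move=> f_ge0; under [RHS]eq_integral do rewrite -sumEFin.
rewrite ge0_integral_sum //.
- exact: measurable_sample_domain.
- by move=> y; apply/measurable_EFinP; exact: measurable_prod_densityM.
- move=> y x _; rewrite lee_fin mulr_ge0 // prodr_ge0 // => k _.
  exact/ltW/cond_density_gt0.
Qed.

End Expectation.

(** The sum factorizes over observations, and each factor is at most [1 + e ^+ 2]. *)
Lemma prod_density_chi2 (G0 G1 : param) (e : R) n (x : n.-tuple covariate) :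
  (forall k s, `|density G1 (tnth x k) s - density G0 (tnth x k) s|
     <= e * density G0 (tnth x k) s) ->
  \sum_(y : n.-tuple 'I_K)
    (\prod_(k < n) density G1 (tnth x k) (tnth y k)) ^+ 2 /
    \prod_(k < n) density G0 (tnth x k) (tnth y k) <= (1 + e ^+ 2) ^+ n.
Proof.
move=> near_G.
under eq_bigr do rewrite -prodrXl -prodf_div.
rewrite (sum_prod_tuple (fun k s => density G1 (tnth x k) s ^+ 2 /
  density G0 (tnth x k) s)).
have -> : (1 + e ^+ 2) ^+ n = \prod_(k < n) (1 + e ^+ 2).
  by rewrite prodr_const card_ord.
apply: ler_prod => k _; apply/andP; split.
  apply: sumr_ge0 => s _.
  by rewrite divr_ge0 ?sqr_ge0 // ltW // cond_density_gt0.
apply: sum_sqr_div_le => // [s||]; first exact: cond_density_gt0.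
- exact: sum_cond_density.
- exact: sum_cond_density.
Qed.

Lemma minimax_risk_two_point (Xi Theta : set param) (loss : param -> param -> R)
    (G0 G1 : param) (e s : R) n :
  Theta G0 -> Theta G1 ->
  (forall x k, X x -> `|density G1 x k - density G0 x k| <= e * density G0 x k) ->
  (1 + e ^+ 2) ^+ n <= 2 ->
  (forall a G, 0 <= loss a G) ->
  (forall G, measurable_fun [set: borel param] (loss^~ G : borel param -> R)) ->
  0 <= s -> (forall a, s <= loss a G0 + loss a G1) ->
  ((s / 4)%:E <= minimax_risk h0 h eta0 X mu Xi Theta loss n)%E.
Proof.
move=> TG0 TG1 near_G e_le loss_ge0 mloss s_ge0 sep.
apply: le_ereal_inf_tmp => _ [est [mest _] <-].
set risks := (X in ereal_sup X).
pose risk G := expectation_iid h0 h eta0 X mu G (fun x y => loss (est x y) G).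
have le_sup G : Theta G -> (risk G <= ereal_sup risks)%E.
  by move=> TG; apply: ereal_sup_ubound; exists G.
have mL G y : measurable_fun (domain n) (fun x => loss (est x y) G).
  exact: (measurableT_comp (mloss G) (mest y)).
have mD := @measurable_sample_domain _ _ _ mX n.
(* The supremum is at least the average of the two risks, which accounts for one factor 2 in
   [s / 4]; the other comes from the overlap. *)
suff le_sum : ((s / 2)%:E <= risk G0 + risk G1)%E.
  rewrite leNgt; apply/negP => lt_s.
  have := lteD (le_lt_trans (le_sup _ TG0) lt_s) (le_lt_trans (le_sup _ TG1) lt_s).
  rewrite -EFinD ltNge; apply/negP; rewrite negbK.
  by rewrite (_ : s / 4 + s / 4 = s / 2) //; field.
have m0 := measurable_sum_density G0 (mL G0).
have m1 := measurable_sum_density G1 (mL G1).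
have E0 := expectation_iidE G0 (mL G0) (fun x y => loss_ge0 (est x y) G0).
have E1 := expectation_iidE G1 (mL G1) (fun x y => loss_ge0 (est x y) G1).
have prod_gt0 G (x : n.-tuple covariate) (y : n.-tuple 'I_K) :
    0 < \prod_(k < n) density G (tnth x k) (tnth y k).
  by apply: prodr_gt0 => k _; exact: cond_density_gt0.
have sum_ge0 G x : (0 <= (\sum_(y : n.-tuple 'I_K)
     (\prod_(k < n) density G (tnth x k) (tnth y k)) * loss (est x y) G)%:E)%E.
  by rewrite lee_fin sumr_ge0 // => y _; rewrite mulr_ge0 // ltW.
rewrite /risk E0 E1 -ge0_integralD //; try by apply/measurable_EFinP.
have -> : (s / 2)%:E = (\int[iid mu n]_(x in domain n) (cst (s / 2)%:E x))%E.
  by rewrite integral_cst // -[LHS]mule1; congr (_ * _)%E; exact/esym/iid_sample_domain.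
apply: ge0_le_integral => //.
- by move=> x _; rewrite lee_fin divr_ge0.
- by apply: emeasurable_funD; exact/measurable_EFinP.
move=> x Xx; rewrite /= -EFinD lee_fin -big_split /=.
apply: le_trans (two_weight_sum_ge (prod_gt0 G0 x) (fun y => ltW (prod_gt0 G1 x y))
  (fun y => loss_ge0 (est x y) G0) (fun y => loss_ge0 (est x y) G1) s_ge0
  (fun y => sep (est x y))).
apply: ler_wpM2l => //.
rewrite (sum_prod_tuple (fun k s => density G1 (tnth x k) s)).
rewrite big1 => [|k _]; last exact: sum_cond_density.
(* The label weights under [G1] sum to 1 and the chi-square sum is at most 2, so the overlap is at
   least [1 - 2 / 4]. *)
have := prod_density_chi2 (fun k s => near_G _ s (Xx k)).
lra.
Qed.

End TwoPoint.

(** * From a path of parameters to the rate *)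

Section Rate.
Context {R : realType} {d q K : nat}.
Local Notation covariate := (borel 'cV[R]_d).
Local Notation param := (param R d q K).
Variables (h0 h : 'cV[R]_d -> 'cV[R]_q -> R) (eta0 : 'M[R]_(q, K)).
Variables (X : set covariate) (mX : measurable X).
Variables (mu : probability covariate R) (mu_X : mu X = 1%E).
Hypothesis homogeneous : forall x eta, X x -> h0 x eta = h x eta.
Hypothesis h_meas : forall eta : 'cV[R]_q,
  measurable_fun X (h^~ eta : covariate -> R).
Hypothesis K_gt0 : (0 < K)%N.

(** Both minimax bounds are instances: [a] measures the separation of the loss along the path, [b]
    the speed of the logit, and [e] the length of path that stays admissible for every [n]. *)
Lemma minimax_risk_path (Xi : set param) (Theta : nat -> set param)
    (loss : param -> param -> R) (G : R -> param) (a b e : R) :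
  0 < a -> 0 < b -> 0 < e ->
  (forall n (t : R), (0 < n)%N -> 0 <= t <= e -> Theta n (G t)) ->
  (forall t, par_eta (G t) = par_eta (G 0)) ->
  (forall (t : R) x, 0 <= t -> X x -> `|(dot (par_beta (G t)) x + par_tau (G t)) -
      (dot (par_beta (G 0)) x + par_tau (G 0))| <= b * t) ->
  (forall a G, 0 <= loss a G) ->
  (forall G, measurable_fun [set: borel param] (loss^~ G : borel param -> R)) ->
  (forall (t : R) A, 0 <= t -> a * t ^+ 2 <= loss A (G 0) + loss A (G t)) ->
  forall r : R, 0 < r < 1 -> exists2 C : R, 0 < C & forall n, (0 < n)%N ->
    ((C * n%:R `^ (- r^-1))%:E <=
       minimax_risk h0 h eta0 X mu Xi (Theta n) loss n)%E.
Proof.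
move=> a_gt0 b_gt0 e_gt0 ThetaG eta_const near_G loss_ge0 mloss sep r /andP[r_gt0 r_lt1].
(* The first bound keeps the path admissible. The second gives [b * t <= m / 4] with [m] the inverse
   of the square root of [n], so the relative perturbation is at most [m / 2]. *)
pose c := Num.min e (4 * b)^-1.
have c_gt0 : 0 < c by rewrite lt_min e_gt0 invr_gt0 mulr_gt0.
have c_le_e : c <= e by rewrite ge_min lexx.
have bc_le : b * c <= 4^-1.
  rewrite -(ler_pM2l (_ : 0 < 4)) // mulrA divff // mulrC -ler_pdivlMr ?mulr_gt0 //.
  by rewrite div1r ge_min lexx orbT.
exists (a * c ^+ 2 / 4); first by rewrite divr_gt0 // mulr_gt0 // exprn_gt0.
move=> n n_gt0.
have nR_gt0 : 0 < n%:R :> R by rewrite ltr0n.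
have nR_ge1 : 1 <= n%:R :> R by rewrite ler1n.
pose m : R := (Num.sqrt n%:R)^-1.
have m2 : m ^+ 2 = n%:R^-1 by rewrite exprVn sqr_sqrtr // ltW.
have m_gt0 : 0 < m by rewrite invr_gt0 sqrtr_gt0.
have m_le1 : m <= 1 by rewrite invf_le1 ?sqrtr_gt0 // -[leLHS]sqrtr1 ler_sqrt.
pose t : R := c * m.
have t_ge0 : 0 <= t by exact: mulr_ge0 (ltW c_gt0) (ltW m_gt0).
have t_le : t <= e by rewrite (le_trans _ c_le_e) // ler_piMr ?(ltW c_gt0).
have bt_le : b * t <= 4^-1 * m by rewrite mulrA ler_wpM2r ?(ltW m_gt0).
have bt_ge0 : 0 <= b * t by exact: mulr_ge0 (ltW b_gt0) t_ge0.
have exp_le : expR (b * t) - 1 <= 2^-1 * m.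
  by apply: le_trans (expR_sub1_le _) _; lra.
have exp_ge0 : 0 <= expR (b * t) - 1 by rewrite subr_ge0 -(@expR0 R) ler_expR.
have chi2_le : (1 + (expR (b * t) - 1) ^+ 2) ^+ n <= 2.
  (* The squared perturbation is at most [1 / (4 n)], so its n-fold effect is at most
     [expR (1 / 4)], itself at most [3 / 2]. *)
  apply: (@le_trans _ _ (expR 4^-1)); last first.
    have : 0 <= (4^-1 : R) <= 2^-1 by lra.
    by move=> /expR_sub1_le; lra.
  have -> : 4^-1 = (4^-1 * m ^+ 2) * n%:R :> R by rewrite m2 mulfVK ?gt_eqF.
  rewrite expRM_natr; apply: lerXn2r; rewrite ?nnegrE ?expR_ge0 //.
    by rewrite addr_ge0 ?sqr_ge0.
  apply: le_trans (expR_ge1Dx _); rewrite lerD2l.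
  have -> : 4^-1 * m ^+ 2 = (2^-1 * m) ^+ 2 by field.
  by rewrite ler_sqr ?nnegrE // mulr_ge0 // ltW.
apply: (@le_trans _ _ (a * t ^+ 2 / 4)%:E).
  have -> : a * t ^+ 2 / 4 = a * c ^+ 2 / 4 * n%:R^-1.
    by rewrite exprMn m2; ring.
  rewrite lee_fin ler_wpM2l //.
    by rewrite divr_ge0 // mulr_ge0 ?sqr_ge0 // ltW.
  (* Here [r < 1] enters: for [n >= 1], the power with exponent [- r^-1] lies below the one with
     exponent [-1]. *)
  rewrite -[leRHS]powR_inv1 ?ler0n //; apply: ler_powR => //.
  by rewrite lerN2 invf_ge1 // ltW.
apply: (@minimax_risk_two_point _ _ _ _ _ _ eta0 _ mX _ mu_X homogeneous h_meas
  K_gt0 _ _ _ (G 0) (G t) (expR (b * t) - 1)) => //.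
- by apply: ThetaG => //; rewrite lexx ltW.
- by apply: ThetaG => //; rewrite t_ge0.
- move=> x k Xx; apply: cond_density_perturb; first exact: eta_const.
  exact: near_G.
- by rewrite mulr_ge0 ?sqr_ge0 // ltW.
- by move=> A; exact: sep.
Qed.

End Rate.

(** * Measurability and lower bounds for the two losses *)

Section Losses.
Context {R : realType} {d q K : nat}.
Local Notation param := (param R d q K).
Variable eta0 : 'M[R]_(q, K).

Lemma sqr_l2norm m (v : 'cV[R]_m) : l2norm v ^+ 2 = \sum_(k < m) v k 0 ^+ 2.
Proof. by rewrite sqr_sqrtr // sumr_ge0 // => k _; exact: sqr_ge0. Qed.

Lemma sqr_coord_le_l2norm m (v : 'cV[R]_m) k : v k 0 ^+ 2 <= l2norm v ^+ 2.
Proof.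
by rewrite sqr_l2norm (bigD1 k) //= lerDl sumr_ge0 // => i _; exact: sqr_ge0.
Qed.

Lemma loss_tau_ge0 (A G : param) : 0 <= loss_tau eta0 A G.
Proof.
apply: sumr_ge0 => i _.
by rewrite mulr_ge0 ?exprn_even_ge0.
Qed.

Lemma loss_beta_eta_ge0 (A G : param) : 0 <= loss_beta_eta eta0 A G.
Proof.
rewrite mulr_ge0 ?sqr_ge0 // sumr_ge0 // => i _.
by rewrite mulr_ge0 ?addr_ge0 ?sqr_ge0.
Qed.

Lemma measurable_sqr_l2norm_sub disp (T : measurableType disp) m
    (f : T -> 'cV[R]_m) (v : 'cV[R]_m) :
  (forall k, measurable_fun [set: T] (fun x => f x k 0)) ->
  measurable_fun [set: T] (fun x => l2norm (f x - v) ^+ 2).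
Proof.
move=> mf.
apply: (eq_measurable_fun (fun x => \sum_(k < m) (f x k 0 - v k 0) ^+ 2)).
  by move=> x _; rewrite sqr_l2norm; apply: eq_bigr => k _; rewrite !mxE.
by apply: measurable_sum => k; apply: measurable_funX; exact: measurable_funB.
Qed.

Lemma measurable_par_beta k :
  measurable_fun [set: borel param] (fun G : borel param => par_beta G k 0).
Proof.
apply: measurable_fun_g_sigma_algebra => a; apply: open_preimage_ray => x.
apply: (@continuous_comp _ _ _ (fst \o fst : param -> 'cV[R]_d) (fun v => v k 0)).
  by apply: (@continuous_comp _ _ _ (fst : param -> _) fst); exact: cvg_fst.
exact: coord_continuous.
Qed.

Lemma measurable_par_tau :
  measurable_fun [set: borel param] (par_tau : borel param -> R).
Proof.
apply: measurable_fun_g_sigma_algebra => a; apply: open_preimage_ray => x.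
by apply: (@continuous_comp _ _ _ (fst : param -> _) snd);
  [exact: cvg_fst|exact: cvg_snd].
Qed.

Lemma measurable_par_eta k i :
  measurable_fun [set: borel param] (fun G : borel param => par_eta G k i).
Proof.
apply: measurable_fun_g_sigma_algebra => a; apply: open_preimage_ray => x.
apply: (@continuous_comp _ _ _ (snd : param -> _) (fun M => M k i)).
  exact: cvg_snd.
exact: coord_continuous.
Qed.

Lemma measurable_loss_tau (G : param) :
  measurable_fun [set: borel param] ((loss_tau eta0)^~ G : borel param -> R).
Proof.
apply: measurable_sum_cond => i.
apply: measurable_funM => //; apply: measurable_funX.
apply: measurableT_comp => //; apply: measurable_funB => //.
apply: measurableT_comp => //; exact: measurable_par_tau.
Qed.

Lemma measurable_loss_beta_eta (G : param) :
  measurable_fun [set: borel param] ((loss_beta_eta eta0)^~ G : borel param -> R).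
Proof.
rewrite /loss_beta_eta; apply: measurable_funM => //.
apply: measurable_sum_cond => i.
apply: measurable_funM => //; apply: measurable_funD;
  apply: measurable_sqr_l2norm_sub => k; first exact: measurable_par_beta.
by under eq_fun do rewrite mxE; exact: measurable_par_eta.
Qed.

(** Parallelogram identity: the defect is [(2 * z - x - y) ^+ 2 / 2]. No estimate [z] is close to
    both [x] and [y]. *)
Lemma sqr_sub_le2 (x y z : R) : (y - x) ^+ 2 / 2 <= (z - x) ^+ 2 + (z - y) ^+ 2.
Proof. by have := sqr_ge0 (2 * z - x - y); rewrite !expr2; nra. Qed.

Lemma loss_tau_ge (A G : param) (i : 'I_K) : (i.+1 < K)%N ->
  l2norm (delta_eta eta0 G i) ^+ 4 * (expR (par_tau A) - expR (par_tau G)) ^+ 2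
    <= loss_tau eta0 A G.
Proof.
move=> i_lt; rewrite /loss_tau (bigD1 i) //= real_normK ?num_real // lerDl.
apply: sumr_ge0 => j _; by rewrite mulr_ge0 ?exprn_even_ge0.
Qed.

Lemma loss_beta_eta_ge (A G : param) (i : 'I_K) (v : 'I_d) : (i.+1 < K)%N ->
  expR (par_tau G) ^+ 2 * l2norm (delta_eta eta0 G i) ^+ 2 *
    (par_beta A v 0 - par_beta G v 0) ^+ 2 <= loss_beta_eta eta0 A G.
Proof.
move=> i_lt; rewrite /loss_beta_eta -mulrA ler_wpM2l ?sqr_ge0 //.
rewrite (bigD1 i) //=; apply: ler_wpDr.
  by apply: sumr_ge0 => j _; rewrite mulr_ge0 ?addr_ge0 ?sqr_ge0.
rewrite ler_wpM2l ?sqr_ge0 //; apply: ler_wpDr; first exact: sqr_ge0.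
by have := sqr_coord_le_l2norm (par_beta A - par_beta G) v; rewrite !mxE.
Qed.

End Losses.

(** * Coordinate perturbations of a parameter *)

Lemma coord_le_mx_norm {R : realType} m n (x : 'M[R]_(m, n)) i j :
  `|x i j| <= `|x|.
Proof.
rewrite [leRHS]mx_normrE.
exact: (le_bigmax _ (fun ij : 'I_m * 'I_n => `|x ij.1 ij.2|) (i, j)).
Qed.

Lemma ball_add_delta_mx {R : realType} m n (x : 'M[R]_(m, n)) i j (e t : R) :
  `|t| < e -> ball x e (x + t *: delta_mx i j).
Proof.
move=> t_lt; have e_gt0 : 0 < e by exact: le_lt_trans (normr_ge0 t) t_lt.
split => // k l; rewrite -ball_normE /= !mxE opprD addrA subrr sub0r normrN.
rewrite normrM; case: (_ && _); rewrite ?normr0 ?normr1 ?mulr0 ?mulr1 //.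
Qed.

(** Supplies a base point with a nonzero weight [delta_eta], without which the separation constant
    would vanish. *)
Lemma interior_eta_neq {R : realType} d q K (A : set (param R d q K))
    (u : 'I_q) (i : 'I_K) (c : R) :
  A° !=set0 -> exists2 G : param R d q K, A° G & par_eta G u i != c.
Proof.
move=> [G AG]; have [eq_c|] := eqVneq (par_eta G u i) c; last by exists G.
(* The ball is taken inside the interior, not just inside [A], so that the shifted point is again
   interior. *)
have := open_interior A; rewrite openE => /(_ _ AG) /nbhs_ballP[e /= e_gt0 Ge].
exists (G.1, G.2 + (e / 2) *: delta_mx u i).
  apply: Ge; split => /=; first exact: ballxx.
  by apply: ball_add_delta_mx; rewrite ger0_norm; lra.
rewrite /par_eta /= !mxE !eqxx mulr1; move: eq_c; rewrite /par_eta => ->.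
by rewrite addrC -subr_eq0 addrK gt_eqF // divr_gt0.
Qed.

Lemma dotDZ_delta {R : realType} m (b x : 'cV[R]_m) t v :
  dot (b + t *: delta_mx v 0) x = dot b x + t * x v 0.
Proof.
rewrite /dot [in RHS](bigD1 v) //= (bigD1 v) //= !mxE !eqxx mulr1 mulrDl.
rewrite -!addrA; congr (_ + _); rewrite addrC; congr (_ + _).
by apply: eq_bigr => k /negPf k_neq; rewrite !mxE k_neq mulr0 addr0.
Qed.

(** * The two lower bounds *)

Theorem theorem2 (R : realType) (d q K : nat)
    (d_gt0 : (0 < d)%N) (q_gt0 : (0 < q)%N) (K_gt1 : (1 < K)%N)
    (X : set (borel 'cV[R]_d)) (mX : measurable X)
    (X_bounded : bounded_set (X : set 'cV[R]_d))
    (mu : probability (borel 'cV[R]_d) R) (mu_X : mu X = 1%E)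
    (h0 h : 'cV[R]_d -> 'cV[R]_q -> R)
    (h_meas : forall eta : 'cV[R]_q,
      measurable_fun X (h^~ eta : borel 'cV[R]_d -> R))
    (eta0 : 'M[R]_(q, K))
    (Xi : set (param R d q K)) (Xi_compact : compact Xi)
    (homogeneous : forall x eta, X x -> h0 x eta = h x eta)
    (h_identifiable : strongly_identifiable K mu h)
    (l : nat -> R)
    (l_growth : l n / ln n%:R @[n --> \oo] --> +oo)
    (nondegenerate :
      (\bigcap_(n in [set n | (0 < n)%N]) restricted Xi (l n) n)° !=set0) :
  forall r : R, 0 < r < 1 ->
    (exists2 C : R, 0 < C & forall n, (0 < n)%N ->
      ((C * n%:R `^ (- r^-1))%:E <=
       minimax_risk h0 h eta0 X mu Xi (restricted Xi (l n) n)
         (loss_tau eta0) n)%E) /\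
    (exists2 C : R, 0 < C & forall n, (0 < n)%N ->
      ((C * n%:R `^ (- r^-1))%:E <=
       minimax_risk h0 h eta0 X mu Xi (restricted Xi (l n) n)
         (loss_beta_eta eta0) n)%E).
Proof.
move=> r r01.
have K_gt0 : (0 < K)%N by exact: ltnW.
(* The zero-based index 0 is the first label; it occurs in the sums of the losses because
   [1 < K]. *)
pose i : 'I_K := Ordinal K_gt0; pose u : 'I_q := Ordinal q_gt0.
pose v : 'I_d := Ordinal d_gt0.
(* The ball around [G] lies in the restricted spaces of all [n >= 1] at once, so the base point, the
   path and the constants do not depend on [n]. *)
have [G /nbhs_ballP[e /= e_gt0 Ge] eta_neq] :=
  interior_eta_neq u i (eta0 u i) nondegenerate.
pose D := l2norm (delta_eta eta0 G i).
have D2_gt0 : 0 < D ^+ 2.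
  apply: lt_le_trans (sqr_coord_le_l2norm _ u).
  by rewrite !mxE exprn_even_gt0 // subr_eq0.
have D4_gt0 : 0 < D ^+ 4 by rewrite (exprM D 2 2) exprn_gt0.
pose T := expR (par_tau G); have T_gt0 : 0 < T := expR_gt0 _.
have e2_gt0 : 0 < e / 2 by rewrite divr_gt0.
have in_ball t : 0 <= t <= e / 2 -> `|t| < e by move=> /andP[? ?]; rewrite ger0_norm; lra.
split.
(* Shifting [tau] moves the logit by exactly [t] for every covariate, so its speed is 1. *)
- pose P t : param R d q K := (par_beta G, par_tau G + t, par_eta G).
  have PE t : par_tau (P t) = par_tau G + t by [].
  apply: (@minimax_risk_path _ _ _ _ _ _ eta0 _ mX _ mu_X homogeneous h_meas K_gt0
    _ _ _ P (D ^+ 4 * T ^+ 2 / 2) 1 (e / 2)) => //.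
  + by rewrite divr_gt0 // mulr_gt0 // exprn_gt0.
  + move=> n t n_gt0 /in_ball t_lt; apply: (Ge (P t) _ n n_gt0).
    split => /=; last exact: ballxx.
    split => /=; first exact: ballxx.
    by rewrite -ball_normE /= opprD addrA subrr sub0r normrN.
  + move=> t x t_ge0 _; rewrite !PE mul1r addr0.
    by rewrite (_ : _ - _ = t) ?ger0_norm //; rewrite /P /=; ring.
  + exact: loss_tau_ge0.
  + exact: measurable_loss_tau.
  + move=> t A t_ge0.
    apply: le_trans (lerD (@loss_tau_ge _ _ _ _ eta0 A (P 0) i K_gt1) 
      (@loss_tau_ge _ _ _ _ eta0 A (P t) i K_gt1)).
    rewrite -[delta_eta eta0 (P 0) _]/(delta_eta eta0 G i).
    rewrite -[delta_eta eta0 (P t) _]/(delta_eta eta0 G i) -/D -mulrDr.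
    rewrite (_ : _ / 2 * _ = D ^+ 4 * ((T * t) ^+ 2 / 2)); last by ring.
    rewrite ler_wpM2l ?(ltW D4_gt0) //.
    (* The two values of [expR (par_tau _)] are [T] and [T * expR t], at least [T * t] apart since
       [expR t >= 1 + t]. *)
    apply: le_trans (sqr_sub_le2 _ _ _).
    rewrite !PE addr0 -/T expRD -/T ler_wpM2r //.
    have := expR_ge1Dx t => exp_t.
    rewrite ler_sqr ?nnegrE; nra.
- have [B B_gt0 X_le] : exists2 B : R, 0 < B &
      forall x, X x -> `|(x : 'cV[R]_d) v 0| <= B.
    have [M [Mreal XM]] := X_bounded.
    (* Boundedness controls the norm by any number strictly above [M]; this choice is also
       positive. *)
    exists (`|M| + 1) => [|x Xx]; first by rewrite ltr_pwDr.
    apply: le_trans (coord_le_mx_norm _ _ _) _; apply: XM => //.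
    by rewrite (le_lt_trans (ler_norm M)) // ltrDl.
  (* Moving one coordinate of [beta] changes the logit by [t * x v 0], at most [B * t] on [X]. *)
  pose P t : param R d q K :=
    (par_beta G + t *: delta_mx v 0, par_tau G, par_eta G).
  have PE t : par_beta (P t) v 0 = par_beta G v 0 + t.
    by rewrite /par_beta /= !mxE !eqxx mulr1.
  apply: (@minimax_risk_path _ _ _ _ _ _ eta0 _ mX _ mu_X homogeneous h_meas K_gt0
    _ _ _ P (T ^+ 2 * D ^+ 2 / 2) B (e / 2)) => //.
  + by rewrite divr_gt0 // mulr_gt0 // exprn_gt0.
  + move=> n t n_gt0 /in_ball t_lt; apply: (Ge (P t) _ n n_gt0).
    split => /=; last exact: ballxx.
    split => /=; last exact: ballxx.
    exact: ball_add_delta_mx.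
  + move=> t x t_ge0 Xx.
    rewrite (_ : _ - _ = t * x v 0).
      by rewrite normrM ger0_norm // mulrC ler_wpM2r // X_le.
    by rewrite /P /par_tau /= !dotDZ_delta; ring.
  + exact: loss_beta_eta_ge0.
  + exact: measurable_loss_beta_eta.
  + move=> t A t_ge0.
    apply: le_trans (lerD (@loss_beta_eta_ge _ _ _ _ eta0 A (P 0) i v K_gt1)
      (@loss_beta_eta_ge _ _ _ _ eta0 A (P t) i v K_gt1)).
    rewrite -[delta_eta eta0 (P 0) _]/(delta_eta eta0 G i).
    (* The path fixes [tau] and [eta], so both losses carry the same weight [T ^+ 2 * D ^+ 2], which
       factors out. *)
    rewrite -[delta_eta eta0 (P t) _]/(delta_eta eta0 G i) -/D.
    rewrite -[par_tau (P 0)]/(par_tau G) -[par_tau (P t)]/(par_tau G) -/T -mulrDr.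
    rewrite (_ : _ / 2 * _ = T ^+ 2 * D ^+ 2 * (t ^+ 2 / 2)); last by ring.
    rewrite ler_wpM2l ?(mulr_ge0 (sqr_ge0 T) (sqr_ge0 D)) //.
    apply: le_trans (sqr_sub_le2 _ _ _).
    by rewrite !PE addr0 [_ + t]addrC addrK.
Qed.
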